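(* Fix $s>0$ and $q\ge2$, and let $X$ be a Banach space with $\rho_X(\tau)\le s\tau^2$ for all $\tau>0$. Let $\{Z_n\}_{n=1}^\infty$ be $X$-valued random variables on a common probability space with $\mathbb{E}[\|Z_n\|^q]<\infty$ for all $n\in\mathbb{N}$, and write $S_n=Z_1+\cdots+Z_n$. Assume that for all $n\in\mathbb{N}$, $$\mathbb{E}\big[\|S_n-Z_{n+1}\|^q\big]\ge\mathbb{E}\big[\|S_n\|^q\big].$$ Then for every $n\in\mathbb{N}$, $$\Big(\mathbb{E}\big[\|S_n\|^q\big]\Big)^{1/q}\le 8\sqrt{s+q}\cdot\sqrt{\sum_{j=1}^n\Big(\mathbb{E}\big[\|Z_j\|^q\big]\Big)^{2/q}}.$$
   Context: The modulus of uniform smoothness of a Banach space $X$ is $\rho_X(\tau)=\sup\left\{\frac{\|x+\tau y\|+\|x-\tau y\|}{2}-1:\ x,y\in X,\ \|x\|=\|y\|=1\right\}$ for $\tau>0$. *)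

(* Defs.v *)
From HB Require Import structures.
From mathcomp Require Import all_boot all_order all_algebra.
From mathcomp Require Import all_classical all_reals all_analysis.

Set Implicit Arguments.
Unset Strict Implicit.
Unset Printing Implicit Defensive.

Import Order.TTheory GRing.Theory Num.Theory.
Import numFieldNormedType.Exports.

Local Open Scope classical_set_scope.
Local Open Scope ring_scope.

(* For tau > 0 the set is bounded above by tau (triangle inequality), so the
   real-valued [sup] is a genuine supremum; it is [0] on the empty set, which
   only occurs when X is the zero space. *)
Definition smoothness_modulus (R : realType) (X : normedModType R)
    (tau : R) : R :=
  sup [set r | exists x y : X, [/\ `|x| = 1, `|y| = 1 &
    r = (`|x + tau *: y| + `|x - tau *: y|) / 2 - 1]].

(* X-valued random variables are Borel measurable and, as usual when X is not
   assumed separable, almost surely take values in a separable subset of X.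
   The second clause is automatic for separable X; without it the sum of two
   Borel maps need not be measurable. *)
Definition random_vector d (T : measurableType d) (R : realType)
    (P : probability T R) (X : normedModType R) (Z : T -> X) : Prop :=
  measurable_fun [set: T] (Z : T -> g_sigma_algebraType (@open X)) /\
  exists2 D : set X, countable D & {ae P, forall w, closure D (Z w)}.

(* Z_1 + ... + Z_n; the value Z 0 is not used. *)
Definition partial_sum (T : Type) (R : realType) (X : normedModType R)
    (Z : nat -> T -> X) (n : nat) : T -> X :=
  fun w => \sum_(1 <= j < n.+1) Z j w.

(* Main.v *)
(* Write |f|_q for the L_q norm. Smoothness controls the mean of |x + y| and
   |x - y|, whose half-difference is at most |y|, so a scalar two-point
   inequality gives, with K = 3 s + 2 + 5 q,
     (|x + y|^q + |x - y|^q) / 2 <= (|x|^2 + K |y|^2)^(q/2).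
   Integrating and applying Minkowski's inequality in L_(q/2), with a = |S|_q^2
   and b = K |Z|_q^2, bounds E|S + Z|^q + E|S - Z|^q by 2 (a + b)^(q/2). The
   hypothesis makes the second term at least a^(q/2), and convexity of t^(q/2)
   at the midpoint a + b of a and a + 2 b then gives
     |S + Z|_q^2 <= |S|_q^2 + 2 K |Z|_q^2.
   Induction concludes, since 2 K <= 64 (s + q). *)

Require Import Defs.
From HB Require Import structures.
From mathcomp Require Import all_boot all_order all_algebra.
From mathcomp Require Import all_classical all_reals all_analysis.
From mathcomp Require Import measurable_realfun ring lra.

Set Implicit Arguments.
Unset Strict Implicit.
Unset Printing Implicit Defensive.

Import Order.TTheory GRing.Theory Num.Theory.
Import numFieldNormedType.Exports.

Local Open Scope classical_set_scope.
Local Open Scope ring_scope.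

(** * Scalar inequalities for real powers *)

Section real_inequalities.
Context {R : realType}.
Implicit Types a b p q t u x : R.

Lemma powR_sqr_half a q : 0 <= a -> (a ^+ 2) `^ (q / 2) = a `^ q.
Proof.
move=> a0; rewrite -powR_mulrn// -powRrM; congr (_ `^ _).
by rewrite mulrCA divff ?mulr1// pnatr_eq0.
Qed.

Lemma le_powR a b p : 0 <= p -> 0 <= a -> a <= b -> a `^ p <= b `^ p.
Proof.
move=> p0 a0 ab; apply: ge0_ler_powR => //; rewrite nnegrE//.
exact: le_trans ab.
Qed.

(** From [1 - u <= expR (- u)], the exponential is at most 1/(1 - u), and (1 + u + 2u^2)(1 - u) = 1
    + u^2(1 - 2u) is at least 1 on this range. *)
Lemma expR_le_quad u : u <= 1 / 2 -> expR u <= 1 + u + 2 * u ^+ 2.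
Proof.
move=> u1.
have e0 : 0 < 1 - u by lra.
have : expR u * (1 - u) <= 1.
  have := expR_ge1Dx (- u) => /(ler_wpM2l (expR_ge0 u)).
  by rewrite expRxMexpNx_1.
rewrite -ler_pdivlMr// => /le_trans; apply.
rewrite ler_pdivrMr// -subr_ge0.
rewrite (_ : _ - 1 = u ^+ 2 * (1 - 2 * u)); last by ring.
by rewrite mulr_ge0 ?sqr_ge0//; lra.
Qed.

Lemma powR_le_quad q t : 0 <= q -> -1 < t -> q * t <= 1 / 2 ->
  (1 + t) `^ q <= 1 + q * t + 2 * (q * t) ^+ 2.
Proof.
move=> q0 t1 qt; apply: le_trans (expR_le_quad qt).
rewrite /powR gt_eqF; last by lra.
by rewrite ler_expR ler_wpM2l// le_ln1Dx.
Qed.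

(** Bernoulli's inequality, obtained from Young's: with exponent [p] and its conjugate, the product
    of (1 + pu)^(1/p) and 1 is at most (1 + pu)/p + 1 - 1/p = 1 + u. The case [p = 1] is separate,
    as the conjugate exponent would be infinite. *)
Lemma powR_ge_linear p u : 1 <= p -> 0 <= u -> 1 + p * u <= (1 + u) `^ p.
Proof.
move=> p1 u0.
have [p1'|p1'] := eqVneq p 1; first by rewrite p1' powRr1 ?mul1r//; lra.
have p_gt1 : 1 < p by rewrite lt_neqAle eq_sym p1'.
have p0 : 0 < p by lra.
have pu : 0 <= 1 + p * u by rewrite addr_ge0// mulr_ge0// ltW.
have pv : p^-1 < 1 by rewrite invf_lt1.
have := @conjugate_powR R ((1 + p * u) `^ p^-1) 1 p (1 - p^-1)^-1.
rewrite mulr1 powR1 -powRrM mulVf ?gt_eqF// powRr1// => young.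
have {}young : (1 + p * u) `^ p^-1 <= 1 + u.
  apply: le_trans (young _ _ _ _ _) _ => //.
  - exact: powR_ge0.
  - by rewrite invr_gt0 subr_gt0.
  - by rewrite invrK; lra.
  - rewrite invrK mulrDl mulrAC divff ?gt_eqF// !mul1r; lra.
have -> : 1 + p * u = ((1 + p * u) `^ p^-1) `^ p.
  by rewrite -powRrM mulVf ?gt_eqF// powRr1.
by apply: le_powR => //; [exact: ltW|exact: powR_ge0].
Qed.

(** For qt <= 1/2 the first-order terms of the two upper expansions cancel, leaving 2 + 4(qt)^2,
    while Bernoulli bounds the right side below by 2 + 5(qt)^2. For qt > 1/2 the larger term
    suffices: 2t < 4qt^2 and t^2 <= qt^2, so (1 + t)^2 <= 1 + 5qt^2. This is the source of the
    constant 5. *)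
Lemma powR_two_point1 q t : 2 <= q -> 0 <= t <= 1 ->
  (1 + t) `^ q + (1 - t) `^ q <= 2 * (1 + 5 * q * t ^+ 2) `^ (q / 2).
Proof.
move=> q2 /andP[t0 t1].
have q0 : 0 < q by lra.
have t2 : 0 <= t ^+ 2 by exact: sqr_ge0.
have qt2 : 0 <= q * t ^+ 2 by rewrite mulr_ge0// ltW.
have [qt|qt] := leP (q * t) (1 / 2).
- have t_lt1 : t < 1 by nra.
  have := @powR_le_quad q t (ltW q0) _ qt.
  have := @powR_le_quad q (- t) (ltW q0).
  rewrite mulrN sqrrN => /(_ _ _) h1 /(_ _) h2.
  have := @powR_ge_linear (q / 2) (5 * q * t ^+ 2).
  move=> /(_ _ _) h3.
  have {}h1 := h1 ltac:(lra) ltac:(nra).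
  have {}h2 := h2 ltac:(lra).
  have {}h3 := h3 ltac:(lra) ltac:(lra).
  have : 0 <= (q * t) ^+ 2 by exact: sqr_ge0.
  have e : q / 2 * (5 * q * t ^+ 2) = 5 / 2 * (q * t) ^+ 2 by field.
  by rewrite e in h3; lra.
- have h : (1 + t) `^ q <= (1 + 5 * q * t ^+ 2) `^ (q / 2).
    rewrite -powR_sqr_half; last by lra.
    by apply: le_powR; [lra|exact: sqr_ge0|nra].
  have : (1 - t) `^ q <= (1 + t) `^ q by apply: le_powR; lra.
  lra.
Qed.

(** Homogeneity reduces this to [powR_two_point1]: for [b <= a], not both zero, a = m(1 + t) and b =
    m(1 - t) with m the mean and t = (a - b)/(a + b) in [0, 1]. *)
Lemma powR_two_point a b q : 2 <= q -> 0 <= a -> 0 <= b ->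
  a `^ q + b `^ q <=
  2 * (((a + b) / 2) ^+ 2 + 5 * q * ((a - b) / 2) ^+ 2) `^ (q / 2).
Proof.
move=> q2; wlog ba : a b / b <= a.
  move=> H a0 b0; have [|/ltW] := leP b a; first by move/H; exact.
  move=> /H/(_ b0 a0); rewrite addrC (addrC b); congr (_ <= _ * _ `^ _).
  by rewrite -[in RHS](opprB b) mulNr sqrrN.
move=> a0 b0.
have [a00|a00] := eqVneq a 0.
  have -> : b = 0 by lra.
  by rewrite a00 powR0 ?addr0 ?mulr_ge0 ?powR_ge0//; apply/eqP; lra.
set m := (a + b) / 2; set t := (a - b) / (a + b).
have m0 : 0 < m by rewrite /m divr_gt0//; lra.
have ab0 : a + b != 0 by apply/eqP; lra.
have -> : a = m * (1 + t) by rewrite /m /t; field.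
have -> : b = m * (1 - t) by rewrite /m /t; field.
have t01 : 0 <= t <= 1.
  by rewrite /t divr_ge0 ?ler_pdivrMr; lra.
case/andP: (t01) => t0 t1.
rewrite [(m * (1 + t)) `^ q]powRM ?[(m * (1 - t)) `^ q]powRM; [|lra..].
rewrite (_ : m ^+ 2 + _ = m ^+ 2 * (1 + 5 * q * t ^+ 2)); last by field.
rewrite powRM ?sqr_ge0//; last first.
  by rewrite addr_ge0// mulr_ge0 ?sqr_ge0//; lra.
rewrite (powR_sqr_half _ (ltW m0)).
have := ler_wpM2l (powR_ge0 m q) (powR_two_point1 q2 t01); lra.
Qed.

Lemma powR_midpoint a b p : 1 <= p -> 0 <= a -> 0 <= b ->
  2 * (a + b) `^ p <= a `^ p + (a + 2 * b) `^ p.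
Proof.
move=> p1 a0 b0.
have h : 0 <= (2^-1 : R) <= 1 by lra.
have := @convex_powR R p p1 (Itv01 (andP h).1 (andP h).2) a (a + 2 * b).
rewrite !inE/= !in_itv/= !andbT => /(_ a0); rewrite addr_ge0 ?mulr_ge0//.
move=> /(_ isT); rewrite !convRE /= /unstable.onem.
set c := (X in X `^ p <= _) => cle.
have cE : c = a + b.
  by rewrite (_ : c = 2^-1 * a + (1 - 2^-1) * (a + 2 * b))//; field.
by rewrite cE in cle; lra.
Qed.

(** Put c = sb^2/a, so that ca = sb^2. If c <= a, the smoothness bound squares to a^2 + 2ca + c^2 <=
    a^2 + 3ca. If c > a, then a^2 <= sb^2, and the triangle bound gives (a + b)^2 <= 2a^2 + 2b^2. *)
Lemma sqr_mean_le s a b m : 0 < s -> 0 < a -> 0 <= b -> 0 <= m ->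
  m <= a + b -> m <= a + s * b ^+ 2 / a ->
  m ^+ 2 <= a ^+ 2 + (3 * s + 2) * b ^+ 2.
Proof.
move=> s0 a0 b0 m0 mab mc.
set c := s * b ^+ 2 / a in mc.
have ca : c * a = s * b ^+ 2 by rewrite /c mulfVK// gt_eqF.
have c0 : 0 <= c by rewrite /c divr_ge0 ?mulr_ge0 ?sqr_ge0// ltW.
have b2 : 0 <= b ^+ 2 by exact: sqr_ge0.
have [cle|clt] := leP c a.
- have h1 : m ^+ 2 <= (a + c) ^+ 2.
    by rewrite ler_sqr ?nnegrE//; lra.
  have h2 : c ^+ 2 <= c * a by rewrite expr2 ler_wpM2l.
  have -> : a ^+ 2 + (3 * s + 2) * b ^+ 2 =
            a ^+ 2 + 3 * (c * a) + 2 * b ^+ 2 by rewrite ca; ring.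
  have e : (a + c) ^+ 2 = a ^+ 2 + 2 * (c * a) + c ^+ 2 by ring.
  lra.
- have h1 : m ^+ 2 <= (a + b) ^+ 2 by rewrite ler_sqr ?nnegrE//; lra.
  have h2 : a ^+ 2 <= c * a by rewrite expr2 ler_wpM2r// ltW.
  have h3 : 0 <= (a - b) ^+ 2 by exact: sqr_ge0.
  have h4 : 0 <= a ^+ 2 by exact: sqr_ge0.
  have e1 : (a + b) ^+ 2 = 2 * a ^+ 2 + 2 * b ^+ 2 - (a - b) ^+ 2 by ring.
  have e2 : (3 * s + 2) * b ^+ 2 = 3 * (c * a) + 2 * b ^+ 2 by rewrite ca; ring.
  lra.
Qed.

End real_inequalities.

(** * Two-point inequalities in a uniformly smooth space *)

Section smooth_space.
Context {R : realType} {X : normedModType R}.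
Implicit Types (x y : X) (s q tau : R).

Lemma smoothness_modulus_ge tau x y : 0 < tau -> `|x| = 1 -> `|y| = 1 ->
  (`|x + tau *: y| + `|x - tau *: y|) / 2 - 1 <= smoothness_modulus X tau.
Proof.
move=> tau0 x1 y1; apply: ub_le_sup; last by exists x, y.
exists tau => _ [u [v [u1 v1 ->]]].
have := ler_normD u (tau *: v); have := ler_normB u (tau *: v).
rewrite normrZ u1 v1 gtr0_norm// mulr1; lra.
Qed.

(** The modulus is applied to the normalised vectors x/|x| and y/|y| at tau = |y|/|x|, and the
    result is multiplied by |x|. *)
Lemma smooth_mean_le s x y :
  (forall tau, 0 < tau -> smoothness_modulus X tau <= s * tau ^+ 2) ->
  x != 0 ->
  (`|x + y| + `|x - y|) / 2 <= `|x| + s * `|y| ^+ 2 / `|x|.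
Proof.
move=> smooth x0.
have [->|y0] := eqVneq y 0.
  by rewrite addr0 subr0 normr0 expr0n/= mulr0 mul0r addr0; lra.
have nx : 0 < `|x| by rewrite normr_gt0.
have ny : 0 < `|y| by rewrite normr_gt0.
have tau0 : 0 < `|y| / `|x| by rewrite divr_gt0.
have nz (z : X) : z != 0 -> `| `|z|^-1 *: z| = 1 :> R.
  by move=> z0; rewrite normrZ normfV normr_id mulVf// normr_eq0.
have := le_trans (smoothness_modulus_ge tau0 (nz x x0) (nz y y0))
                 (smooth _ tau0).
rewrite scalerA mulrAC mulfV ?gt_eqF// mul1r -scalerDr -scalerBr.
rewrite !normrZ normfV normr_id -mulrDr -mulrA.
set S := (_ + _) / 2 => h.
have : `|x| * (`|x|^-1 * S) <= `|x| * (1 + s * (`|y| / `|x|) ^+ 2).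
  by apply: ler_wpM2l; [exact: ltW|lra].
rewrite mulVKf ?gt_eqF// => /le_trans; apply.
rewrite le_eqVlt; apply/orP; left; apply/eqP.
by field; rewrite gt_eqF.
Qed.

Lemma smooth_two_point s q x y : 0 < s -> 2 <= q ->
  (forall tau, 0 < tau -> smoothness_modulus X tau <= s * tau ^+ 2) ->
  `|x + y| `^ q + `|x - y| `^ q <=
  2 * (`|x| ^+ 2 + (3 * s + 2 + 5 * q) * `|y| ^+ 2) `^ (q / 2).
Proof.
move=> s0 q2 smooth.
have y2 : 0 <= `|y| ^+ 2 by exact: sqr_ge0.
(* [smooth_mean_le] requires [x != 0]. At [x = 0] the left side is twice the [q]-th power of |y|,
   and the constant in front of |y|^2 is at least 1. *)
have [->|x0] := eqVneq x 0.
  rewrite add0r sub0r normrN normr0 expr0n add0r/= -powR_sqr_half//.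
  set B := (X in _ <= 2 * X).
  have : (`|y| ^+ 2) `^ (q / 2) <= B by apply: le_powR => //; nra.
  lra.
apply: le_trans (powR_two_point _ _ _) _ => //.
rewrite ler_pM2l//; apply: le_powR; first lra.
  by apply: addr_ge0; [exact: sqr_ge0|apply: mulr_ge0; [lra|exact: sqr_ge0]].
have h1 : ((`|x + y| + `|x - y|) / 2) ^+ 2 <=
    `|x| ^+ 2 + (3 * s + 2) * `|y| ^+ 2.
  apply: sqr_mean_le => //; rewrite ?normr_gt0 ?divr_ge0 ?addr_ge0//.
    by have := ler_normD x y; have := ler_normB x y; lra.
  exact: smooth_mean_le.
have h2 : ((`|x + y| - `|x - y|) / 2) ^+ 2 <= `|y| ^+ 2.
  have h3 : `|x + y| - `|x - y| <= 2 * `|y|.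
    rewrite (_ : x + y = (x - y) + 2 *: y); last first.
      by rewrite scaler_nat mulr2n addrA addrNK.
    have := ler_normD (x - y) (2 *: y); rewrite normrZ normr_nat; lra.
  have h4 : `|x - y| - `|x + y| <= 2 * `|y|.
    rewrite (_ : x - y = (x + y) - 2 *: y); last first.
      by rewrite scaler_nat mulr2n opprD addrA addrK.
    have := ler_normB (x + y) (2 *: y); rewrite normrZ normr_nat; lra.
  (* A difference of squares: both factors of the remainder are nonnegative by [h3] and [h4]. *)
  have -> : `|y| ^+ 2 = ((`|x + y| - `|x - y|) / 2) ^+ 2 +
     (2 * `|y| - (`|x + y| - `|x - y|)) * (2 * `|y| - (`|x - y| - `|x + y|)) / 4.
    by field.
  by rewrite lerDl divr_ge0// mulr_ge0// subr_ge0.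
have : 5 * q * ((`|x + y| - `|x - y|) / 2) ^+ 2 <= 5 * q * `|y| ^+ 2.
  by rewrite ler_wpM2l//; lra.
lra.
Qed.
End smooth_space.

(** * Strong measurability of vector-valued maps *)

Definition separably_valued {R : realType} {X : normedModType R}
    (T : Type) (f : T -> X) : Prop :=
  exists (I : countType) (u : I -> X),
    forall w e, 0 < e -> exists i, `|f w - u i| < e.

(** Separability is imposed at every point, not almost surely, which makes the class closed under
    addition. Random vectors enter it after being set to zero on a null set, by [vanish_on]. *)
Definition strongly_measurable d (T : measurableType d) (R : realType)
    (X : normedModType R) (f : T -> X) : Prop :=
  (forall U : set X, open U -> measurable (f @^-1` U)) /\ separably_valued f.

Section strongly_measurable.
Context d (T : measurableType d) (R : realType) (X : normedModType R).
Implicit Types f g : T -> X.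

Lemma strongly_measurableN f :
  strongly_measurable f -> strongly_measurable (fun w => - f w).
Proof.
move=> [mf [I [u uf]]]; split.
  move=> U oU; apply: (mf (-%R @^-1` U)).
  by apply: open_comp => // x _; exact: opp_continuous.
exists I, (fun i => - u i) => w e /(uf w)[i fi]; exists i.
by rewrite -opprD normrN.
Qed.

(* Separability of the ranges makes the preimage of an open set under the sum
   a countable union of intersections of preimages of balls. *)
Lemma strongly_measurableD f g : strongly_measurable f ->
  strongly_measurable g -> strongly_measurable (fun w => f w + g w).
Proof.
move=> [mf [I [u uf]]] [mg [J [v vg]]]; split; last first.
  exists (I * J)%type, (fun p => u p.1 + v p.2) => w e e0.
  have e20 : 0 < e / 2 by rewrite divr_gt0.
  have [i fi] := uf w _ e20; have [j gj] := vg w _ e20.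
  exists (i, j) => /=; rewrite opprD addrACA.
  by apply: le_lt_trans (ler_normD _ _) _; lra.
move=> U oU.
pose r (k : nat) : R := k.+1%:R^-1.
have r0 k : 0 < r k by rewrite invr_gt0.
(* The first factor does not depend on [w]: it is everything or empty, and selects the balls of
   radius 2r about u + v that lie inside [U]. *)
pose F (p : I * J * nat) : set T :=
  [set w | ball (u p.1.1 + v p.1.2) (2 * r p.2) `<=` U] `&`
  (f @^-1` ball (u p.1.1) (r p.2) `&` g @^-1` ball (v p.1.2) (r p.2)).
rewrite (_ : _ @^-1` U = \bigcup_p F p).
  apply: countable_bigcupT_measurable; first exact: countableP.
  move=> [[i j] k]; rewrite /F /=.
  have [inU|notinU] := pselect (ball (u i + v j) (2 * r k) `<=` U).
    rewrite (_ : [set _ | _] = setT) ?setTI; last by apply/seteqP; split.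
    by apply: measurableI; [apply: mf|apply: mg]; exact: ball_open.
  by rewrite (_ : [set _ | _] = set0) ?set0I//; apply/seteqP; split.
apply/seteqP; split => [w /= Uw|w [[[i j] k] _] [/= inU [fi gj]]].
  have /nbhs_ballP[e /= e0 eU] : nbhs (f w + g w) U by exact: open_nbhs_nbhs.
  (* The quarter pays for four radii: one each for [f] and [g], and two for the ball about u + v. *)
  have [k ke] := @ltr_add_invr R 0 (e / 4) ltac:(lra).
  rewrite add0r in ke; have rk := r0 k; rewrite -/(r k) in ke.
  have [i fi] := uf w _ rk; have [j gj] := vg w _ rk.
  exists (i, j, k) => //; rewrite /F /= -!ball_normE /=; split; last first.
    by rewrite -normrN opprB in fi; rewrite -normrN opprB in gj.
  move=> x /= hx; apply: eU; rewrite -ball_normE /=.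
  rewrite (_ : _ - x = (f w - u i) + (g w - v j) + (u i + v j - x)).
    apply: le_lt_trans (ler_normD _ _) _.
    by have := ler_normD (f w - u i) (g w - v j); lra.
  by rewrite (addrACA (f w)) -opprD addrA subrK.
apply: inU; rewrite -!ball_normE /= in fi gj *.
by rewrite opprD addrACA; apply: le_lt_trans (ler_normD _ _) _; lra.
Qed.

Lemma strongly_measurable_norm f :
  strongly_measurable f -> measurable_fun [set: T] (fun w => `|f w|).
Proof.
move=> [mf _]; apply: (measurability _ (RGenOInfty.measurableE R)) => //.
move=> /= _ [_ [x ->] <-]; rewrite setTI.
apply: (mf ((fun z : X => `|z|) @^-1` `]x, +oo[%classic)).
by apply: open_comp => //; move=> z _; exact: norm_continuous.
Qed.

Lemma strongly_measurable_sum (Z : nat -> T -> X) n :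
  (forall j, (1 <= j)%N -> strongly_measurable (Z j)) ->
  strongly_measurable (partial_sum Z n).
Proof.
move=> mZ; rewrite /partial_sum; elim: n => [|n ih].
  rewrite (_ : (fun _ => _) = cst 0); last first.
    by apply/funext => w; rewrite big_geq.
  split=> [U _|].
    have [U0|U0] := pselect (U 0).
      by rewrite preimage_cst mem_set.
    by rewrite preimage_cst memNset.
  by exists unit, (fun=> 0) => w e e0; exists tt; rewrite subrr normr0.
rewrite (_ : (fun _ => _) =
  fun w => \sum_(1 <= j < n.+1) Z j w + Z n.+1 w); last first.
  by apply/funext => w; rewrite big_nat_recr.
by apply: strongly_measurableD => //; exact: mZ.
Qed.

End strongly_measurable.

(** * Expectations and null sets *)

Section expectation.
Context d (T : measurableType d) (R : realType) (P : probability T R).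
Local Open Scope ereal_scope.
Import HBNNSimple.

(* The sums S_n need only be measurable off a null set, so [ge0_ae_eq_integral],
   which assumes both functions measurable, does not apply. *)
Lemma expectation_eq_off_null (N : set T) (f g : T -> R) :
  measurable N -> P N = 0 ->
  (forall w, (0 <= f w)%R) -> (forall w, (0 <= g w)%R) ->
  (forall w, ~ N w -> f w = g w) -> 'E_P[f] = 'E_P[g].
Proof.
move=> mN PN0.
wlog suff main : f g / (forall w, (0 <= f w)%R) -> (forall w, (0 <= g w)%R) ->
    (forall w, ~ N w -> f w = g w) -> 'E_P[f] <= 'E_P[g].
  move=> f0 g0 fg; apply/eqP; rewrite eq_le !main// => w Nw.
  by rewrite fg.
move=> f0 g0 fg; rewrite unlock !ge0_integralTE//.
apply: ge_ereal_sup => _ [h /= hf <-].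
have mNC : measurable (~` N) by exact: measurableC.
(* The simple function [h] below [f], cut to zero on [N], lies below [g] everywhere and keeps its
   integral because [N] is null. *)
apply: ereal_sup_ubound; exists (proj_nnsfun h mNC) => /=.
  move=> w; rewrite mindicE; have [Nw|Nw] := boolP (w \in ~` N).
    by rewrite mulr1 -fg//; exact: set_mem Nw.
  by rewrite mulr0 lee_fin.
transitivity (sintegral P (h \_ setT)); last by rewrite patch_setT.
rewrite -mrestrict -!integral_nnsfun// -setTD.
rewrite [RHS](ge0_negligible_integral mN)//.
  exact/measurable_EFinP.
by move=> w _; rewrite lee_fin.
Qed.

End expectation.

(** * One step of the moment recursion *)

Lemma half_neq0 (R : realType) (q : R) : 2 <= q -> q / 2 != 0.
Proof. by move=> q2; rewrite gt_eqF//; lra. Qed.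

Section smooth_step.
Variables (d : measure_display) (T : measurableType d) (R : realType)
  (P : probability T R) (X : normedModType R) (s q : R).
Implicit Types f g : T -> X.

Lemma measurable_norm_powR f : strongly_measurable f ->
  measurable_fun [set: T] (fun w => (`|f w| `^ q)%R).
Proof.
move=> /strongly_measurable_norm mf.
exact: (measurableT_comp (measurable_powR q) mf).
Qed.

Lemma expectation_two_point f g : 0 < s -> 2 <= q ->
  (forall tau : R, 0 < tau -> smoothness_modulus X tau <= s * tau ^+ 2) ->
  strongly_measurable f ->
  strongly_measurable g ->
  ('E_P[fun w => (`|f w + g w| `^ q)%R] + 'E_P[fun w => (`|f w - g w| `^ q)%R]
  <= 2%:E * 'E_P[fun w => ((`|f w| ^+ 2 + (3 * s + 2 + 5 * q) * `|g w| ^+ 2)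
                           `^ (q / 2))%R])%E.
Proof.
move=> s_gt0 q_ge2 X_smooth mf mg; rewrite unlock.
have mD : strongly_measurable (fun w => f w + g w)%R.
  exact: strongly_measurableD.
have mB : strongly_measurable (fun w => f w - g w)%R.
  by apply: strongly_measurableD => //; exact: strongly_measurableN.
have mG : measurable_fun [set: T] (fun w =>
    (`|f w| ^+ 2 + (3 * s + 2 + 5 * q) * `|g w| ^+ 2) `^ (q / 2))%R.
  apply: (measurableT_comp (measurable_powR _)).
  apply: measurable_funD; first exact/measurable_funX/strongly_measurable_norm.
  apply: measurable_funM => //.
  exact/measurable_funX/strongly_measurable_norm.
rewrite -ge0_integralD//; [|exact/measurable_EFinP/measurable_norm_powR..].
rewrite -ge0_integralZl_EFin//; last 2 first.
- by move=> w _; rewrite lee_fin powR_ge0.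
- exact/measurable_EFinP.
apply: ge0_le_integral => //.
- by move=> w _; rewrite -EFinD lee_fin addr_ge0 ?powR_ge0.
- by apply: emeasurable_funD; exact/measurable_EFinP/measurable_norm_powR.
- by apply: measurable_funeM; exact/measurable_EFinP.
- by move=> w _; rewrite -EFinD -EFinM lee_fin; exact: smooth_two_point.
Qed.

(** The L_(q/2) norm of |f|^2 is the square of the L_q norm of |f|, so this is Minkowski's
    inequality with exponent q/2, which is at least 1 because [2 <= q]. *)
Lemma expectation_minkowski f g (k : R) : 2 <= q -> (0 <= k)%R ->
  strongly_measurable f -> strongly_measurable g ->
  ('E_P[fun w => ((`|f w| ^+ 2 + k * `|g w| ^+ 2) `^ (q / 2))%R] <=
  ('E_P[fun w => (`|f w| `^ q)%R] `^ (2 / q) +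
   k%:E * 'E_P[fun w => (`|g w| `^ q)%R] `^ (2 / q)) `^ (q / 2))%E.
Proof.
move=> q_ge2 k0 mf mg.
have q2_neq0 := half_neq0 q_ge2; have q2V := invf_div q 2.
have mk : measurable_fun [set: T] (fun w => k * `|g w| ^+ 2)%R.
  apply: measurable_funM => //.
  exact/measurable_funX/strongly_measurable_norm.
have mf2 : measurable_fun [set: T] (fun w => `|f w| ^+ 2)%R.
  exact/measurable_funX/strongly_measurable_norm.
have kg0 w : (0 <= k * `|g w| ^+ 2)%R by rewrite mulr_ge0// sqr_ge0.
have Nf : 'N[P]_((q / 2)%:E)[EFin \o (fun w => `|f w| ^+ 2)%R]%E =
    ('E_P[fun w => (`|f w| `^ q)%R] `^ (2 / q))%E.
  rewrite Lnorm.unlock expectation.unlock q2V; congr (_ `^ _)%E.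
  apply: eq_integral => w _ /=.
  by rewrite ger0_norm ?sqr_ge0// powR_sqr_half.
have Ng : 'N[P]_((q / 2)%:E)[EFin \o (fun w => k * `|g w| ^+ 2)%R]%E =
    (k%:E * 'E_P[fun w => (`|g w| `^ q)%R] `^ (2 / q))%E.
  rewrite Lnorm.unlock expectation.unlock q2V.
  transitivity ((\int[P]_w ((k `^ (q / 2))%:E * (`|g w| `^ q)%:E)) `^ (2 / q))%E.
    congr (_ `^ _)%E; apply: eq_integral => w _ /=.
    by rewrite ger0_norm// powRM ?sqr_ge0// powR_sqr_half.
  rewrite ge0_integralZl_EFin ?powR_ge0//; last exact/measurable_EFinP/measurable_norm_powR.
  rewrite poweRM ?lee_fin ?powR_ge0//; last first.
    by apply: integral_ge0 => w _; rewrite lee_fin powR_ge0.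
  rewrite poweR_EFin -powRrM -q2V divff// powRr1//.
have q21 : (1 <= q / 2)%R by lra.
have := minkowski_EFin P mf2 mk q21; rewrite Nf Ng => minkowski.
have -> : 'E_P[fun w => ((`|f w| ^+ 2 + k * `|g w| ^+ 2) `^ (q / 2))%R]%E =
    ('N[P]_((q / 2)%:E)[EFin \o ((fun w => `|f w| ^+ 2) \+
                               (fun w => k * `|g w| ^+ 2))%R] `^ (q / 2))%E.
  rewrite poweR_Lnorm// expectation.unlock.
  apply: eq_integral => w _ /=.
  by rewrite ger0_norm// addr_ge0 ?sqr_ge0.
apply: gt0_ler_poweR minkowski; rewrite ?in_itv/= ?leey ?andbT ?Lnorm_ge0//.
  lra.
by rewrite adde_ge0 ?mule_ge0 ?poweR_ge0 ?lee_fin.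
Qed.

Lemma expectation_step f g : 0 < s -> 2 <= q ->
  (forall tau : R, 0 < tau -> smoothness_modulus X tau <= s * tau ^+ 2) ->
  strongly_measurable f -> strongly_measurable g ->
  ('E_P[fun w => (`|f w| `^ q)%R] < +oo ->
  'E_P[fun w => (`|g w| `^ q)%R] < +oo ->
  'E_P[fun w => (`|f w| `^ q)%R] <= 'E_P[fun w => (`|f w - g w| `^ q)%R] ->
  'E_P[fun w => (`|f w + g w| `^ q)%R] `^ (2 / q) <=
  'E_P[fun w => (`|f w| `^ q)%R] `^ (2 / q) +
  (2 * (3 * s + 2 + 5 * q))%:E * 'E_P[fun w => (`|g w| `^ q)%R] `^ (2 / q))%E.
Proof.
move=> s_gt0 q_ge2 X_smooth mf mg.
have q2_neq0 := half_neq0 q_ge2; have q2V := invf_div q 2.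
set K := (3 * s + 2 + 5 * q)%R.
have K0 : (0 <= K)%R by rewrite /K; lra.
have := expectation_minkowski q_ge2 K0 mf mg.
have := expectation_two_point s_gt0 q_ge2 X_smooth mf mg; rewrite -/K.
have E0 (h : T -> X) : (0 <= 'E_P[fun w => (`|h w| `^ q)%R])%E.
  by apply: expectation_ge0 => w; exact: powR_ge0.
move: (E0 f) (E0 g) (E0 (fun w => f w + g w)%R).
(* From here only the numerical relations between the expectations matter. [a] and [b] are finite by
   hypothesis; [e1] is left extended, and its finiteness comes out of the estimate. *)
move: ('E_P[fun w => (`|f w| `^ q)%R])%E => [a| |]//.
move: ('E_P[fun w => (`|g w| `^ q)%R])%E => [b| |]//.
move: ('E_P[fun w => (`|f w + g w| `^ q)%R])%E => e1.
move: ('E_P[fun w => (`|f w - g w| `^ q)%R])%E => e2.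
move: ('E_P[_])%E => e3.
move=> a0 b0 e10 two_point minkowski _ _ lower.
have {two_point lower} : (e1 + a%:E <= 2%:E * e3)%E.
  by apply: le_trans two_point; rewrite leeD2l.
set u := a `^ (2 / q).
set v := K * b `^ (2 / q).
have {}minkowski : (e3 <= ((u + v) `^ (q / 2))%:E)%E.
  by rewrite -poweR_EFin EFinD EFinM.
have -> : a = (u `^ (q / 2))%R.
  by rewrite /u -powRrM -q2V mulVf// powRr1.
have : (2%:E * e3 <= (2 * (u + v) `^ (q / 2))%:E)%E.
  by rewrite EFinM; apply: lee_wpmul2l.
move=> /[swap] /le_trans/[apply].
case: e1 e10 => // e1; rewrite !lee_fin => e10 le_e1.
have u0 : (0 <= u)%R by exact: powR_ge0.
have v0 : (0 <= v)%R by rewrite mulr_ge0 ?powR_ge0.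
have mid := @powR_midpoint R u v (q / 2) ltac:(lra) u0 v0.
have powK x : 0 <= x -> (x `^ (q / 2)) `^ (2 / q) = x.
  by move=> x0; rewrite -powRrM -q2V divff// powRr1.
rewrite -mulrA -/v powK//.
(* With [mid], e1 + u^(q/2) <= 2(u + v)^(q/2) <= u^(q/2) + (u + 2v)^(q/2); cancelling bounds [e1] by
   (u + 2v)^(q/2), and the power 2/q finishes. *)
rewrite -[leRHS]powK; last by lra.
apply: le_powR => //; first by rewrite divr_ge0//; lra.
lra.
Qed.

End smooth_step.

(** * Modification on a null set *)

Section vanish_on.
Context d (T : measurableType d) (R : realType) (X : normedModType R).

Definition vanish_on (N : set T) (f : T -> X) : T -> X :=
  fun w => if w \in N then 0 else f w.

Lemma strongly_measurable_vanish_on (N : set T) (D : set X) (f : T -> X) :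
  measurable N ->
  measurable_fun [set: T] (f : T -> g_sigma_algebraType (@open X)) ->
  countable D -> (forall w, ~ N w -> closure D (f w)) ->
  strongly_measurable (vanish_on N f).
Proof.
move=> mN mf cD Df; split.
  move=> U oU.
  have mfU : measurable (f @^-1` U).
    rewrite -[X in measurable X]setTI; apply: (mf measurableT U).
    exact: sub_sigma_algebra.
  rewrite (_ : _ @^-1` U = (N `&` [set w | U 0]) `|` (f @^-1` U `\` N)).
    apply: measurableU; last exact: measurableD.
    by have [U0|U0] := pselect (U 0);
      [rewrite (_ : [set _ | _] = setT) ?setIT//|
       rewrite (_ : [set _ | _] = set0) ?setI0//]; apply/seteqP; split.
  apply/seteqP; split => w; rewrite /vanish_on /=.
    by case: (boolP (w \in N)) => [/set_mem|/negP]; rewrite ?inE; tauto.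
  by case: (boolP (w \in N)) => [/set_mem|/negP]; rewrite ?inE; tauto.
have /countable_injP[i iinj] := cD.
pose u (n : nat) : X := xget 0 [set x | D x /\ i x = n].
(* [None] approximates the value 0 taken on [N]; [Some n] runs through [D] via the injection [i],
   with 0 as default at indices outside its image. *)
exists (option nat), (fun o => if o is Some n then u n else 0) => w e e0.
rewrite /vanish_on; case: ifPn => wN.
  by exists None; rewrite subrr normr0.
have Nw : ~ N w by move=> /mem_set; apply/negP.
have [x [Dx fx]] := Df w Nw _ (nbhsx_ballx (f w) e e0).
exists (Some (i x)).
have [Du iu] : D (u (i x)) /\ i (u (i x)) = i x.
  by apply: (@xgetPex _ 0 [set y | D y /\ i y = i x]); exists x.
by rewrite (iinj _ _ (mem_set Du) (mem_set Dx) iu); rewrite -ball_normE in fx.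
Qed.

End vanish_on.

(** * Induction on the number of summands *)

Section induction.
Context (d : measure_display) (T : measurableType d) (R : realType)
  (P : probability T R) (X : normedModType R) (s q : R) (Z : nat -> T -> X).

Lemma partial_sumS n :
  partial_sum Z n.+1 = (fun w => partial_sum Z n w + Z n.+1 w).
Proof. by apply/funext => w; rewrite /partial_sum big_nat_recr. Qed.

(** Finiteness of the moment of the partial sum is carried along because [expectation_step] requires
    it at the next index. *)
Lemma expectation_partial_sum : 0 < s -> 2 <= q ->
  (forall tau : R, 0 < tau -> smoothness_modulus X tau <= s * tau ^+ 2) ->
  (forall n, (1 <= n)%N -> strongly_measurable (Z n)) ->
  (forall n, (1 <= n)%N -> 'E_P[fun w => (`|Z n w| `^ q)%R] < +oo)%E ->
  (forall n, (1 <= n)%N ->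
      'E_P[fun w => (`|partial_sum Z n w| `^ q)%R] <=
       'E_P[fun w => (`|partial_sum Z n w - Z n.+1 w| `^ q)%R])%E ->
  forall n, (1 <= n)%N ->
  ('E_P[fun w => (`|partial_sum Z n w| `^ q)%R] < +oo)%E /\
  ('E_P[fun w => (`|partial_sum Z n w| `^ q)%R] `^ (2 / q) <=
   (64 * (s + q))%:E *
   \sum_(1 <= j < n.+1) 'E_P[fun w => (`|Z j w| `^ q)%R] `^ (2 / q))%E.
Proof.
move=> s_gt0 q_ge2 X_smooth mZ finZ lower.
have q2 : 2 / q != 0 by rewrite gt_eqF// divr_gt0//; lra.
have K0 : 0 <= 64 * (s + q) by lra.
elim=> [//|[_ _|n /(_ isT)[finS ih] _]].
  have -> : partial_sum Z 1 = Z 1%N.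
    by apply/funext => w; rewrite /partial_sum big_nat1.
  split; first exact: finZ.
  rewrite big_nat1 -[leLHS]mul1e; apply: lee_wpmul2r; first exact: poweR_ge0.
  by rewrite lee_fin; lra.
have mS := strongly_measurable_sum n.+1 mZ.
have step := expectation_step s_gt0 q_ge2 X_smooth mS (mZ n.+2 isT) finS
  (finZ n.+2 isT) (lower n.+1 isT).
rewrite partial_sumS; split.
  apply: (lty_poweRy q2); apply: le_lt_trans step _.
  rewrite lte_add_pinfty ?poweR_lty// lte_mul_pinfty ?poweR_lty ?finZ//.
  by rewrite lee_fin; lra.
apply: le_trans step _.
rewrite big_nat_recr//= muleDr; last 2 first.
- by rewrite fin_numE.
- apply: ge0_adde_def; rewrite inE ?poweR_ge0//.
  by apply: sume_ge0 => j _; exact: poweR_ge0.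
apply: leeD => //; apply: lee_wpmul2r; first exact: poweR_ge0.
(* Here 2(3s + 2 + 5q) = 6s + 4 + 10q <= 6s + 12q, since 4 <= 2q. *)
by rewrite lee_fin; lra.
Qed.
End induction.

(** * Reduction to everywhere separable values, and conclusion *)

Theorem theorem2p1 (R : realType) (s q : R) (X : completeNormedModType R)
    (d : measure_display) (T : measurableType d) (P : probability T R)
    (Z : nat -> T -> X)
    (s_gt0 : 0 < s) (q_ge2 : 2 <= q)
    (X_smooth : forall tau : R, 0 < tau ->
      smoothness_modulus X tau <= s * tau ^+ 2)
    (Z_rv : forall n : nat, (1 <= n)%N -> random_vector P (Z n))
    (Z_moment : forall n : nat, (1 <= n)%N ->
      ('E_P[fun w => (`|Z n w| `^ q)%R] < +oo)%E)
    (Z_lower : forall n : nat, (1 <= n)%N ->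
      ('E_P[fun w => (`|partial_sum Z n w| `^ q)%R] <=
       'E_P[fun w => (`|partial_sum Z n w - Z n.+1 w| `^ q)%R])%E)
    (n : nat) (n_ge1 : (1 <= n)%N) :
  ('E_P[fun w => (`|partial_sum Z n w| `^ q)%R] `^ q^-1 <=
   (8 * Num.sqrt (s + q))%:E *
   sqrte (\sum_(1 <= j < n.+1) 'E_P[fun w => (`|Z j w| `^ q)%R] `^ (2 / q)))%E.
Proof.
(* A countable union of null sets gives a single exceptional set for all indices; the shift to
   [n.+1] avoids [Z 0], about which nothing is assumed. *)
have [N [mN PN0 sN]] : exists N : set T, [/\ measurable N, P N = 0 &
    forall n, (1 <= n)%N -> exists2 D : set X, countable D &
      forall w, ~ N w -> closure D (Z n w)].
  have /choice[D HD] : forall n, exists D : set X,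
      countable D /\ {ae P, forall w, closure D (Z n.+1 w)}.
    by move=> k; have [_ [D cD aeD]] := Z_rv k.+1 isT; exists D.
  have [N [mN PN0 sN]] := negligible_bigcup (fun k => (HD k).2).
  exists N; split => // -[//|k] _; exists (D k); first by case: (HD k).
  move=> w Nw; apply: contrapT => Dw; apply: Nw; apply: sN.
  by exists k.
pose Z' k := vanish_on N (Z k).
have Z'E k w : ~ N w -> Z' k w = Z k w.
  by move=> Nw; rewrite /Z' /vanish_on memNset.
have S'E k w : ~ N w -> partial_sum Z' k w = partial_sum Z k w.
  by move=> Nw; apply: eq_bigr => j _; exact: Z'E.
have EE (f g : T -> X) : (forall w, ~ N w -> f w = g w) ->
    'E_P[fun w => (`|f w| `^ q)%R]%E = 'E_P[fun w => (`|g w| `^ q)%R]%E.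
  move=> fg; apply: (expectation_eq_off_null mN PN0) => w.
  - exact: powR_ge0.
  - exact: powR_ge0.
  - by move=> Nw; rewrite fg.
have mZ' k : (1 <= k)%N -> strongly_measurable (Z' k).
  move=> k1; have [D cD Df] := sN k k1; have [mZ _] := Z_rv k k1.
  exact: strongly_measurable_vanish_on cD Df.
have [] := @expectation_partial_sum d T R P X s q Z' s_gt0 q_ge2 X_smooth mZ'
  _ _ n n_ge1.
- by move=> k k1; rewrite (EE _ (Z k)) ?Z_moment// => w; exact: Z'E.
- move=> k k1; rewrite (EE _ (partial_sum Z k)); last by move=> w; exact: S'E.
  rewrite [leRHS](EE _ (fun w => partial_sum Z k w - Z k.+1 w)) ?Z_lower//.
  by move=> w Nw; rewrite S'E// Z'E.
move=> _; rewrite (EE _ (partial_sum Z n)); last by move=> w; exact: S'E.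
under eq_bigr do rewrite (EE _ (Z _) (Z'E _)).
set E := 'E_P[_]%E; set S := (\sum_(_ <= _ < _) _)%E => main.
have S0 : (0 <= S)%E by apply: sume_ge0 => j _; exact: poweR_ge0.
(* [main] is the square of the claim, so both sides are rewritten as powers 1/2, with 64 = 8^2. *)
have -> : (E `^ q^-1 = (E `^ (2 / q)) `^ 2^-1)%E.
  by rewrite -poweRrM; congr (_ `^ _)%E; rewrite mulrAC mulfV ?mul1r.
have -> : 8 * Num.sqrt (s + q) = (64 * (s + q)) `^ 2^-1.
  rewrite powR12_sqrt; last by lra.
  rewrite sqrtrM// (_ : 64 = 8 ^+ 2) ?sqrtr_sqr ?ger0_norm//.
  by rewrite -natrX.
rewrite -poweR_EFin -(poweR12_sqrt S0) -poweRM//; last by rewrite lee_fin; lra.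
apply: gt0_ler_poweR main => //; rewrite in_itv/= leey andbT ?poweR_ge0//.
by rewrite mule_ge0// lee_fin; lra.
Qed.
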